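(* Let $f$ be a ReLU network, $\mathcal{X}\subset\mathbb{R}^{n_0}$ an open set expressible by quadratic or linear constraints, $p\in\{1,2,\infty\}$ and $\varepsilon\ge0$. The problem $(\underline{\mathcal{P}})_\varepsilon$ (defined in the context, with the $L^p$-norm) is equivalent, in the sense that the optimal values coincide, to the problem $$(\underline{\mathcal{P}}_p)_\varepsilon\quad\left\{\begin{array}{ll}\displaystyle\max_{y,\sigma,x}&\|y_L\|_p\\ \text{s.t.}& y_k=M_k\,\mathrm{diag}(\sigma_{k-1})\,y_{k-1},\quad k=2,\dots,L,\\ & y_1=M_1y_0,\\ & x_k=\sigma_k\odot(M_kx_{k-1}+b_k),\quad k=1,\dots,L-1,\\ & (\sigma_k-\tfrac12)\odot(M_kx_{k-1}+b_k)\ge\varepsilon,\quad k=1,\dots,L-1,\\ & \sigma_k\in\{0,1\}^{n_k},\quad k=1,\dots,L-1,\\ & x_0\in\mathcal{X},\\ & \|y_0\|_p\le1,\end{array}\right.$$ where $y=(y_0,\dots,y_L)$ with $y_k\in\mathbb{R}^{n_k}$, $\sigma=(\sigma_1,\dots,\sigma_{L-1})$, and $x=(x_0,\dots,x_{L-1})$ with $x_k\in\mathbb{R}^{n_k}$.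
   Context: Network. $f:\mathbb{R}^{n_0}\to\mathbb{R}^{n_L}$, $f=T_L\circ\rho_{L-1}\circ T_{L-1}\circ\cdots\circ\rho_1\circ T_1$, where $T_k(x)=M_kx+b_k$ maps $\mathbb{R}^{n_{k-1}}$ to $\mathbb{R}^{n_k}$ and $\rho_k$ applies $\mathrm{ReLU}(t)=\max(t,0)$ componentwise on $\mathbb{R}^{n_k}$. The pre-activation of layer $k$ is $\theta_k=T_k\circ\rho_{k-1}\circ T_{k-1}\circ\cdots\circ\rho_1\circ T_1$, with $i$-th component $\theta_k^i$; $\sigma_k^i$ is the $i$-th component of $\sigma_k$. Problem $(\underline{\mathcal{P}})_\varepsilon$ with the $L^p$-norm: maximize $N_p(\sigma)=\|M_L\,\mathrm{diag}(\sigma_{L-1})M_{L-1}\cdots\mathrm{diag}(\sigma_1)M_1\|_p$ (operator norm induced by the vector norms $\|\cdot\|_p$) over $x\in\mathcal{X}$ and $\sigma_k\in\{0,1\}^{n_k}$ ($k=1,\dots,L-1$) subject to $(\sigma_k^i-\tfrac12)\theta_k^i(x)\ge\varepsilon$ for all $k\in\{1,\dots,L-1\}$, $i\in\{1,\dots,n_k\}$. $\odot$ is the Hadamard (componentwise) product; $\sigma_k-\tfrac12$ subtracts $\tfrac12$ from each component; vector inequalities are componentwise. The optimal value of an infeasible maximization problem is $-\infty$. *)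

(* Defs.v *)
From HB Require Import structures.
From mathcomp Require Export all_boot all_order all_algebra.
From mathcomp Require Export all_classical all_reals all_analysis.
Export numFieldNormedType.Exports.
Export Order.TTheory GRing.Theory Num.Theory.

Set Implicit Arguments.
Unset Strict Implicit.
Unset Printing Implicit Defensive.

Local Open Scope classical_set_scope.
Local Open Scope ring_scope.

(* For p = -oo the value 0 is a dummy; in the case p = +oo the neutral
   element 0 is harmless because absolute values are nonnegative. *)
Definition lpnorm (R : realType) (p : \bar R) (n : nat) (v : 'cV[R]_n) : R :=
  match p with
  | r%:E%E => (\sum_(i < n) `|v i 0| `^ r) `^ r^-1
  | +oo%E => \big[Num.max/0]_(i < n) `|v i 0|
  | -oo%E => 0
  end.

(* The set is bounded; for n = 0 it is empty, and sup set0 = 0. *)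
Definition opnorm (R : realType) (p : \bar R) (m n : nat) (A : 'M[R]_(m, n)) :
    R :=
  sup [set lpnorm p (A *m v) / lpnorm p v | v in [set v : 'cV[R]_n | v != 0]].

Definition hadamard (R : realType) (m n : nat) (A B : 'M[R]_(m, n)) :
    'M[R]_(m, n) :=
  map2_mx *%R A B.

Definition relu (R : realType) (n : nat) (v : 'cV[R]_n) : 'cV[R]_n :=
  map_mx (fun t => Num.max t 0) v.

(* Layers are numbered 1, ..., depth, as in f = T_L \o ... \o T_1, and width 0
   is the input dimension; weight k and bias k are M_k and b_k. Families are
   indexed by all of nat to avoid casts: weight 0, bias 0 and all entries of
   index greater than depth are never used. *)
Record relu_network (R : realType) := ReluNetwork {
  depth : nat;
  depth_gt0 : (0 < depth)%N;
  width : nat -> nat;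
  weight : forall k : nat, 'M[R]_(width k, width k.-1);
  bias : forall k : nat, 'cV[R]_(width k) }.

Section Network.
Variables (R : realType) (f : relu_network R).

(* One vector for each layer; the same convention on unused indices applies. *)
Definition layer_family := forall k : nat, 'cV[R]_(width f k).

Definition affine (k : nat) (v : 'cV[R]_(width f k.-1)) : 'cV[R]_(width f k) :=
  weight f k *m v + bias f k.

Fixpoint hidden (x : 'cV[R]_(width f 0)) (k : nat) : 'cV[R]_(width f k) :=
  match k with
  | 0%N => x
  | j.+1 => relu (affine (k := j.+1) (hidden x j))
  end.

(* theta_k *)
Definition preactivation (x : 'cV[R]_(width f 0)) (k : nat) :
    'cV[R]_(width f k) :=
  affine (hidden x k.-1).

Definition network_fun (x : 'cV[R]_(width f 0)) : 'cV[R]_(width f (depth f)) :=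
  preactivation x (depth f).

Definition diag (k : nat) (s : 'cV[R]_(width f k)) : 'M[R]_(width f k) :=
  diag_mx s^T.

(* M_(j+1) diag(s_j) M_j ... diag(s_1) M_1 *)
Fixpoint masked_product (s : layer_family) (j : nat) :
    'M[R]_(width f j.+1, width f 0) :=
  match j with
  | 0%N => weight f 1
  | i.+1 => weight f i.+2 *m diag (s i.+1) *m masked_product s i
  end.

Definition binary_vector (n : nat) (v : 'cV[R]_n) : Prop :=
  forall i, v i 0 = 0 \/ v i 0 = 1.

(* N_p(s); the product has depth factors M_k. *)
Definition masked_norm (p : \bar R) (s : layer_family) : R :=
  opnorm p (masked_product s (depth f).-1).

Definition feasible (eps : R) (X : set 'cV[R]_(width f 0))
    (x : 'cV[R]_(width f 0)) (s : layer_family) : Prop :=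
  [/\ X x,
      forall k, (1 <= k < depth f)%N -> binary_vector (s k) &
      forall k, (1 <= k < depth f)%N -> forall i,
        eps <= (s k i 0 - 2^-1) * preactivation x k i 0].

Definition optimal_value (p : \bar R) (eps : R)
    (X : set 'cV[R]_(width f 0)) : \bar R :=
  ereal_sup [set v | exists x s,
    feasible eps X x s /\ v = (masked_norm p s)%:E].

Definition feasible_expanded (p : \bar R) (eps : R)
    (X : set 'cV[R]_(width f 0)) (y s x : layer_family) : Prop :=
  [/\ (forall k, (2 <= k <= depth f)%N ->
         y k = weight f k *m diag (s k.-1) *m y k.-1),
      y 1%N = weight f 1 *m y 0%N,
      (forall k, (1 <= k < depth f)%N ->
         x k = hadamard (s k) (weight f k *m x k.-1 + bias f k)),
      (forall k, (1 <= k < depth f)%N -> forall i,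
         eps <= hadamard (s k - const_mx 2^-1)
                         (weight f k *m x k.-1 + bias f k) i 0) &
      [/\ (forall k, (1 <= k < depth f)%N -> binary_vector (s k)),
          X (x 0%N) &
          lpnorm p (y 0%N) <= 1]].

Definition optimal_value_expanded (p : \bar R) (eps : R)
    (X : set 'cV[R]_(width f 0)) : \bar R :=
  ereal_sup [set v | exists y s x,
    feasible_expanded p eps X y s x /\ v = (lpnorm p (y (depth f)))%:E].

End Network.

Definition quadratic_fun (R : realType) (n : nat) (Q : 'M[R]_n) (c : 'cV[R]_n)
    (d : R) (x : 'cV[R]_n) : R :=
  (x^T *m Q *m x) 0 0 + (c^T *m x) 0 0 + d.

(* Finitely many constraints q(x) <= 0 or q(x) < 0; a linear constraint is the
   case Q = 0 and an equality is a pair of opposite inequalities. *)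
Definition quadratically_constrained (R : realType) (n : nat)
    (X : set 'cV[R]_n) : Prop :=
  exists (m : nat) (Q : 'I_m -> 'M[R]_n) (c : 'I_m -> 'cV[R]_n)
         (d : 'I_m -> R) (weak : 'I_m -> bool),
    X = [set x | forall j,
           quadratic_fun (Q j) (c j) (d j) x < 0 ?<= if weak j].

(* Main.v *)
Require Import Defs.
From mathcomp Require Import lra.
Local Open Scope classical_set_scope.
Local Open Scope ring_scope.

(** The hidden variables of the expanded problem are determined by the free
    ones, so that it is the original problem with the operator norm unfolded
    into a maximum over the unit ball.

    A binary s with (s - 1/2) t >= eps >= 0 satisfies s t = max(t, 0): the sign
    of t forces s, and if t = 0, which can happen for eps = 0, both choices of s
    give 0 ([relu_hadamard]). Hence the constraints on x say that x_k is the
    output of the k-th hidden layer at x_0 ([hidden_unique]), and the sign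
    constraints of the two problems coincide. The recursion for y gives
    y_L = (M_L diag(s_(L-1)) ... diag(s_1) M_1) y_0 ([masked_product_unique]).
    For a fixed activation pattern, the values ||A y_0|| with ||y_0|| <= 1 have
    ||A|| as least upper bound ([lpnorm_mulmx_le], [opnorm_le]); the original
    problem maximizes the operator norm ||A|| of the same matrices A.

    That ||A|| is finite and equal to this supremum follows from homogeneity
    of the norm and its comparison with the largest entry of a vector, which hold
    for every exponent 0 < p <= +oo. *)

(** * The entrywise p-norm *)

Section LpNorm.
Set Implicit Arguments.
Unset Strict Implicit.
Context {R : realType}.
Implicit Types (p : \bar R) (m n : nat).

Lemma lpnorm_ge0 p n (v : 'cV[R]_n) : 0 <= lpnorm p v.
Proof.
case: p => [r| |] //=; first exact: powR_ge0.
by elim/big_ind: _ => // x y x0 y0; rewrite le_max x0.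
Qed.

Lemma lpnormZ p n (a : R) (v : 'cV[R]_n) : (0 < p)%E ->
  lpnorm p (a *: v) = `|a| * lpnorm p v.
Proof.
case: p => [r| |] //= => [|_].
- rewrite lte_fin => r0.
  under eq_bigr do rewrite mxE normrM powRM//.
  rewrite -mulr_sumr powRM ?powR_ge0//; last first.
    by apply: sumr_ge0 => i _; exact: powR_ge0.
  by rewrite -powRrM divff ?gt_eqF// powRr1.
- elim/big_ind2: _ => [|x1 x2 y1 y2 -> ->|i _]; first by rewrite mulr0.
    by rewrite maxr_pMr.
  by rewrite mxE normrM.
Qed.

Lemma lpnorm0 p n : (0 < p)%E -> lpnorm p (0 : 'cV[R]_n) = 0.
Proof. by move=> p0; rewrite -(scale0r (0 : 'cV[R]_n)) lpnormZ// normr0 mul0r. Qed.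

Lemma ler_norm_entry_lpnorm p n (v : 'cV[R]_n) (i : 'I_n) : (0 < p)%E ->
  `|v i 0| <= lpnorm p v.
Proof.
case: p => [r| |] //= => [|_]; last exact: (le_bigmax _ (fun j => `|v j 0|)).
rewrite lte_fin => r0.
rewrite -[leLHS]powRr1// -(@divff _ r) ?gt_eqF// powRrM.
have rV0 : 0 <= r^-1 by rewrite invr_ge0 ltW.
apply: ge0_ler_powR; rewrite ?nnegrE ?powR_ge0//.
  by apply: sumr_ge0 => j _; exact: powR_ge0.
by rewrite (bigD1 i)//= lerDl sumr_ge0// => j _; exact: powR_ge0.
Qed.

Lemma lpnorm_gt0 p n (v : 'cV[R]_n) : (0 < p)%E -> v != 0 -> 0 < lpnorm p v.
Proof.
move=> p0 v0; rewrite lt_neqAle lpnorm_ge0 andbT eq_sym.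
apply: contra_neq v0 => v0; apply/colP => i; rewrite mxE.
by apply/normr0_eq0/le_anti; rewrite normr_ge0 -v0 ler_norm_entry_lpnorm.
Qed.

(** The constant is the norm of the all-ones vector. *)
Lemma lpnorm_le_entries p n (v : 'cV[R]_n) (c : R) : (0 < p)%E -> 0 <= c ->
  (forall i, `|v i 0| <= c) -> lpnorm p v <= c * lpnorm p (const_mx 1 : 'cV[R]_n).
Proof.
move=> p0 c0 vc; rewrite -[c in leRHS]ger0_norm// -lpnormZ//.
have {}vc i : `|v i 0| <= `|(c *: (const_mx 1 : 'cV[R]_n)) i 0|.
  by rewrite mxE mxE mulr1 (ger0_norm c0).
case: p p0 => [r| |] //= => [|_]; last by apply: le_bigmax2 => i _.
rewrite lte_fin => r0.
have rV0 : 0 <= r^-1 by rewrite invr_ge0 ltW.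
apply: ge0_ler_powR; rewrite ?nnegrE ?powR_ge0//.
- by apply: sumr_ge0 => j _; exact: powR_ge0.
- by apply: sumr_ge0 => j _; exact: powR_ge0.
- by apply: ler_sum => i _; apply: ge0_ler_powR; rewrite ?nnegrE// ?vc// ltW.
Qed.

End LpNorm.

(** * The operator norm as a least upper bound over the unit ball *)

Section OperatorNorm.
Set Implicit Arguments.
Unset Strict Implicit.
Context {R : realType}.
Variables (p : \bar R) (m n : nat) (A : 'M[R]_(m, n)).
Hypothesis p_gt0 : (0 < p)%E.

(** Every entry of A v is at most (the sum of all |A i j|) * ||v||. *)
Lemma has_ubound_lpnorm_ratio :
  has_ubound [set lpnorm p (A *m v) / lpnorm p v | v in [set v : 'cV[R]_n | v != 0]].
Proof.
pose c : R := \sum_i \sum_j `|A i j|.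
exists (c * lpnorm p (const_mx 1 : 'cV[R]_m)) => _ [v /= v0 <-].
rewrite ler_pdivrMr ?lpnorm_gt0// mulrAC.
have c0 : 0 <= c by apply: sumr_ge0 => i _; exact: sumr_ge0.
apply: lpnorm_le_entries => //; first by rewrite mulr_ge0 ?lpnorm_ge0.
move=> i; rewrite mxE (le_trans (ler_norm_sum _ _ _))//.
rewrite (@le_trans _ _ ((\sum_j `|A i j|) * lpnorm p v))//.
  rewrite mulr_suml ler_sum// => j _.
  by rewrite normrM ler_wpM2l// ler_norm_entry_lpnorm.
rewrite ler_wpM2r ?lpnorm_ge0// /c (bigD1 i)//= lerDl.
by apply: sumr_ge0 => k _; exact: sumr_ge0.
Qed.

Lemma lpnorm_mulmx_le (v : 'cV[R]_n) :
  lpnorm p (A *m v) <= opnorm p A * lpnorm p v.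
Proof.
have [->|v0] := eqVneq v 0; first by rewrite mulmx0 !lpnorm0// mulr0.
rewrite -ler_pdivrMr ?lpnorm_gt0//.
by apply: ub_le_sup; [exact: has_ubound_lpnorm_ratio|exists v].
Qed.

Lemma opnorm_ge0 : 0 <= opnorm p A.
Proof.
rewrite /opnorm; set S := [set _ | _ in _].
have [->|/set0P[r Sr]] := eqVneq S set0; first by rewrite sup0.
apply: (@le_trans _ _ r).
  by case: Sr => v _ <-; rewrite divr_ge0 ?lpnorm_ge0.
by apply: ub_le_sup; first exact: has_ubound_lpnorm_ratio.
Qed.

(** Each ratio ||A v|| / ||v|| is the value of ||A w|| at w = v / ||v||. The
    bound is extended real so that it can be the optimal value of a problem; if
    n = 0 there is no ratio, the operator norm is 0, and the zero vector of the
    unit ball shows that the bound is nonnegative. *)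
Lemma opnorm_le (c : \bar R) :
  (forall v : 'cV[R]_n, lpnorm p v <= 1 -> ((lpnorm p (A *m v))%:E <= c)%E) ->
  ((opnorm p A)%:E <= c)%E.
Proof.
move=> Ac.
have c0 : (0 <= c)%E by have := Ac 0; rewrite mulmx0 !lpnorm0//; apply.
case: c Ac c0 => [c| |] Ac c0 //; last by rewrite leey.
rewrite lee_fin /opnorm; set S := [set _ | _ in _].
have [->|S0] := eqVneq S set0; first by rewrite sup0 -lee_fin.
apply: ge_sup; first exact/set0P.
move=> _ [v /= v0 <-]; have nv0 := lpnorm_gt0 p_gt0 v0.
have nvV : `|(lpnorm p v)^-1| = (lpnorm p v)^-1 by rewrite ger0_norm ?invr_ge0 ?ltW.
have := Ac ((lpnorm p v)^-1 *: v).
rewrite -scalemxAr !lpnormZ// nvV mulVf ?gt_eqF// lee_fin mulrC; exact.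
Qed.

End OperatorNorm.

(** * Determination of the intermediate variables *)

Section Network.
Set Implicit Arguments.
Unset Strict Implicit.
Context {R : realType} {f : relu_network R}.
Implicit Types (s x y : layer_family f).

Lemma relu_hadamard n (s t : 'cV[R]_n) (eps : R) : 0 <= eps -> binary_vector s ->
  (forall i, eps <= (s i 0 - 2^-1) * t i 0) -> relu t = hadamard s t.
Proof.
move=> eps0 s01 st; apply/colP => i; rewrite !mxE.
case: (s01 i) (st i) => -> ti.
  by rewrite mul0r max_r//; lra.
by rewrite mul1r max_l//; lra.
Qed.

Lemma hidden_step (v : 'cV[R]_(width f 0)) k : (0 < k)%N ->
  hidden v k = relu (preactivation v k).
Proof. by case: k. Qed.

Lemma hadamard_sign n (s t : 'cV[R]_n) i :
  hadamard (s - const_mx 2^-1) t i 0 = (s i 0 - 2^-1) * t i 0.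
Proof. by rewrite !mxE. Qed.

(** At each layer the sign constraint refers to x_(k-1), which is already the
    output of the previous hidden layer, so that s_k acts on it as the ReLU. *)
Lemma hidden_unique (eps : R) s x : 0 <= eps ->
  (forall k, (1 <= k < depth f)%N -> binary_vector (s k)) ->
  (forall k, (1 <= k < depth f)%N ->
     x k = hadamard (s k) (weight f k *m x k.-1 + bias f k)) ->
  (forall k, (1 <= k < depth f)%N -> forall i,
     eps <= hadamard (s k - const_mx 2^-1)
                     (weight f k *m x k.-1 + bias f k) i 0) ->
  forall k, (k < depth f)%N -> x k = hidden (x 0%N) k.
Proof.
move=> eps0 s01 xE sx; elim=> // k IH kL.
rewrite /= -IH 1?ltnW// xE//.
rewrite (relu_hadamard eps0 (s01 k.+1 kL))// => i.
by rewrite -hadamard_sign; exact: sx.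
Qed.

Lemma masked_product_unique s y :
  (forall k, (2 <= k <= depth f)%N ->
     y k = weight f k *m diag (s k.-1) *m y k.-1) ->
  y 1%N = weight f 1 *m y 0%N ->
  forall j, (j < depth f)%N -> y j.+1 = masked_product s j *m y 0%N.
Proof.
move=> yE y1; elim=> // j IH jL.
by rewrite yE// /= IH 1?ltnW// mulmxA.
Qed.

(** [depth f] is not a successor by computation, so that y_L and the matrix
    [masked_product s (depth f).-1] have different types; their norms can be
    compared. *)
Lemma lpnorm_output (p : \bar R) s y :
  (forall k, (2 <= k <= depth f)%N ->
     y k = weight f k *m diag (s k.-1) *m y k.-1) ->
  y 1%N = weight f 1 *m y 0%N ->
  lpnorm p (y (depth f)) = lpnorm p (masked_product s (depth f).-1 *m y 0%N).
Proof.
move=> yE y1; have := masked_product_unique yE y1.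
by case: (depth f) (depth_gt0 f) => // L _ ->.
Qed.

Definition forward_pass s (v : 'cV[R]_(width f 0)) : layer_family f :=
  fun k => match k with 0%N => v | j.+1 => masked_product s j *m v end.

Lemma forward_pass_step s v k : (2 <= k)%N ->
  forward_pass s v k = weight f k *m diag (s k.-1) *m forward_pass s v k.-1.
Proof. by case: k => [|[|k]] //= _; rewrite mulmxA. Qed.

Lemma feasible_of_expanded (p : \bar R) (eps : R) X y s x : 0 <= eps ->
  feasible_expanded p eps X y s x -> feasible eps X (x 0%N) s.
Proof.
move=> eps0 [_ _ xE sx [s01 Xx _]]; split => // -[//|k] kL i.
rewrite /preactivation /= -(hidden_unique eps0 s01 xE sx) 1?ltnW//.
by rewrite -hadamard_sign; exact: sx.
Qed.

Lemma expanded_of_feasible (p : \bar R) (eps : R) X s v u : 0 <= eps ->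
  feasible eps X u s -> lpnorm p v <= 1 ->
  feasible_expanded p eps X (forward_pass s v) s (hidden u).
Proof.
move=> eps0 [Xu s01 su] v1; split => //.
- by move=> k /andP[k2 _]; exact: forward_pass_step.
- move=> k kL; rewrite hidden_step; last by case/andP: kL.
  exact: relu_hadamard eps0 (s01 _ kL) (su _ kL).
- by move=> k kL i; rewrite hadamard_sign; exact: su.
Qed.

End Network.

(** * Equality of the optimal values *)

Theorem mainTheorem3 (R : realType) (f : relu_network R)
    (X : set 'cV[R]_(width f 0)) (X_open : open X)
    (X_quad : quadratically_constrained X)
    (p : \bar R) (p_val : p = 1%:E \/ p = 2%:E \/ p = +oo%E)
    (eps : R) (eps_ge0 : 0 <= eps) :
  optimal_value p eps X = optimal_value_expanded p eps X.
Proof.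
have p0 : (0 < p)%E by case: p_val => [->|[->|->]]; rewrite ?lte_fin.
apply/le_anti/andP; split; apply: ge_ereal_sup.
(* An input v in the unit ball, propagated through the masked layers, gives a
   feasible point of value ||A v||. *)
- move=> _ [u [s [us ->]]]; apply: opnorm_le => // v v1.
  have [yE y1 _ _ _] := expanded_of_feasible eps_ge0 us v1.
  apply: ereal_sup_ubound; exists (forward_pass s v), s, (hidden u).
  by split; [exact: expanded_of_feasible|rewrite (lpnorm_output p yE y1)].
- move=> _ [y [s [x [yx ->]]]].
  apply: (@le_trans _ _ (masked_norm p s)%:E); last first.
    by apply: ereal_sup_ubound; exists (x 0%N), s; split => //;
       exact: feasible_of_expanded yx.
  have [yE y1 _ _ [_ _ y0]] := yx.
  rewrite lee_fin (lpnorm_output p yE y1) (le_trans (lpnorm_mulmx_le _ p0 _))//.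
  by rewrite ler_piMr// opnorm_ge0.
Qed.
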